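(* Let $n\ge 2$, $B_r^+=\{x=(x',x_n)\in\mathbb{R}^n: |x|<r,\ x_n>0\}$, $Q_1^+=B_1^+\times(0,1)$, $Q_{1/2}^+=B_{1/2}^+\times(\tfrac34,1)$ and $\Sigma=\{x\in\mathbb{R}^n:|x|<1,\ x_n=0\}\times(0,1)$. (i) (Stokes equations) There is no constant $c$ such that $$\|\nabla w\|_{L^2(Q^+_{1/2})}\le c\,\|w\|_{L^2(Q^+_1)}$$ holds for all regular solutions $(w,\pi)$ of $$w_t-\Delta w+\nabla\pi=0,\quad \operatorname{div} w=0\ \text{ in } Q_1^+,\qquad w=0\ \text{ on }\Sigma .$$ More precisely, there is a sequence of regular solutions $(w_k,\pi_k)$ of this problem such that $\sup_k\|w_k\|_{L^2(Q_1^+)}<\infty$ and $\|\nabla w_k\|_{L^2(Q_{1/2}^+)}\to\infty$ as $k\to\infty$. (ii) (Navier-Stokes equations) There is no constant $c$ such that $$\|\nabla u\|^2_{L^2(Q^+_{1/2})}\le c\left(\|u\|^2_{L^2(Q^+_1)}+\|u\|^3_{L^3(Q^+_1)}\right)$$ holds for all regular solutions $(u,p)$ of $$u_t-\Delta u+\nabla p=-\operatorname{div}(u\otimes u),\quad \operatorname{div} u=0\ \text{ in } Q_1^+,\qquad u=0\ \text{ on }\Sigma .$$ More precisely, there is a sequence of regular solutions $(u_k,p_k)$ of this problem such that $\sup_k\left(\|u_k\|^2_{L^2(Q^+_1)}+\|u_k\|^3_{L^3(Q^+_1)}\right)<\infty$ and $\|\nabla u_k\|_{L^2(Q_{1/2}^+)}\to\infty$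 as $k\to\infty$.
   Context: The unknown velocities $w,u$ take values in $\mathbb{R}^n$ and the pressures $\pi,p$ are scalar. The no-slip boundary condition is imposed only on the flat part $\Sigma$ of the lateral boundary; nothing is prescribed on the rounded boundary $\{|x|=1,\ x_n>0\}\times(0,1)$ or at the initial time. ''Regular solution'' means that the velocity belongs to the parabolic Sobolev space $W^{2,1}_2(Q_1^+)$ (the velocity, its first and second spatial derivatives and its first time derivative are in $L^2(Q_1^+)$), that the gradient of the pressure is in $L^2(Q_1^+)$, that the equations hold almost everywhere, and that the boundary condition holds in the trace sense. $\operatorname{div}(u\otimes u)$ is the vector with components $\sum_{j}D_{x_j}(u_iu_j)$. *)

(* Defs.v *)
From HB Require Import structures.
From mathcomp Require Import all_boot all_order all_algebra.
From mathcomp Require Import all_classical all_reals all_analysis.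

Set Implicit Arguments.
Unset Strict Implicit.
Unset Printing Implicit Defensive.

Import Order.TTheory GRing.Theory Num.Theory.
Import numFieldNormedType.Exports.

Local Open Scope classical_set_scope.
Local Open Scope ring_scope.

(* The sigma-algebra on row vectors is the one generated by the coordinates,
   i.e. the Borel sigma-algebra of R^n.                                       *)
Section measurable_rV.
Context {d} {T : measurableType d}.
Variable n : nat.

Let coord : 'I_n -> 'rV[T]_n -> T := fun i x => x ord0 i.

Let rV_set0 : g_sigma_preimage coord set0.
Proof. exact: sigma_algebra0. Qed.

Let rV_setC A : g_sigma_preimage coord A -> g_sigma_preimage coord (~` A).
Proof. exact: sigma_algebraC. Qed.

Let rV_bigcup (F : _^nat) : (forall i, g_sigma_preimage coord (F i)) ->
  g_sigma_preimage coord (\bigcup_i (F i)).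
Proof. exact: sigma_algebra_bigcup. Qed.

HB.instance Definition _ := @isMeasurable.Build (measure_tuple_display d)
  'rV[T]_n (g_sigma_preimage coord) rV_set0 rV_setC rV_bigcup.

Lemma measurable_coord (i : 'I_n) :
  measurable_fun [set: 'rV[T]_n] (fun x : 'rV[T]_n => x ord0 i).
Proof.
move=> _ Y mY; rewrite setTI; apply: sub_sigma_algebra => /=.
rewrite -bigcup_seq/=; exists i => /=; first by rewrite mem_index_enum.
by exists Y => //; rewrite setTI.
Qed.

Lemma measurable_fun_coordP d1 (T1 : measurableType d1) (f : T1 -> 'rV[T]_n) :
  (forall i, measurable_fun [set: T1] (fun x => f x ord0 i)) ->
  measurable_fun [set: T1] f.
Proof.
move=> mf _ A mA.
have : g_sigma_preimage (fun i => coord i \o f) `<=` measurable.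
  apply: smallest_sub; first exact: sigma_algebra_measurable.
  rewrite -bigcup_seq/=; apply: bigcup_sub => i _ B [C mC <-].
  exact: (mf i).
apply; rewrite g_sigma_preimage_comp; by exists A.
Qed.

End measurable_rV.

Section lebesgue_rV.
Context {R : realType}.

(* (x', a) |-> (x', x_n) with x_n = a *)
Definition snoc n (z : 'rV[R]_n * measurableTypeR R) : 'rV[R]_n.+1 :=
  \row_i oapp (z.1 ord0) z.2 (unlift ord_max i).

Definition unsnoc n (x : 'rV[R]_n.+1) : 'rV[R]_n * measurableTypeR R :=
  (\row_j x ord0 (lift ord_max j), x ord0 ord_max).

Lemma snocK n : cancel (@snoc n) (@unsnoc n).
Proof.
case=> v a; rewrite /unsnoc mxE unlift_none /=; congr pair.
by apply/rowP => j; rewrite !mxE liftK.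
Qed.

Lemma unsnocK n : cancel (@unsnoc n) (@snoc n).
Proof.
by move=> x; apply/rowP => i; rewrite mxE /=; case: unliftP => [j ->|->]//=;
  rewrite mxE.
Qed.

Lemma measurable_snoc n :
  measurable_fun [set: 'rV[R]_n * measurableTypeR R] (@snoc n).
Proof.
apply: measurable_fun_coordP => i; under eq_fun do rewrite mxE.
case: (unlift _ _) => [j|] /=; last exact: measurable_snd.
exact: (measurableT_comp (measurable_coord j) measurable_fst).
Qed.

Lemma measurable_unsnoc n : measurable_fun [set: 'rV[R]_n.+1] (@unsnoc n).
Proof.
apply: (measurable_fun_pair _ (measurable_coord ord_max)).
apply: measurable_fun_coordP => i; under eq_fun do rewrite /= mxE.
exact: measurable_coord.
Qed.

Section step.
Local Open Scope ereal_scope.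
Variables (n : nat) (mu : {sigma_finite_measure set 'rV[R]_n -> \bar R}).

Definition snoc_measure : set 'rV[R]_n.+1 -> \bar R :=
  pushforward (mu \x @lebesgue_measure R) (@snoc n).

Let snoc_measure0 : snoc_measure set0 = 0.
Proof. by rewrite /snoc_measure /pushforward preimage_set0 measure0. Qed.

Let snoc_measure_ge0 A : 0 <= snoc_measure A.
Proof. exact: (@measure_ge0 _ _ _ (mu \x @lebesgue_measure R)). Qed.

Let snoc_measure_sigma_additive : semi_sigma_additive snoc_measure.
Proof.
move=> F mF tF mUF; rewrite /snoc_measure /pushforward preimage_bigcup.
have mpre A : measurable A -> measurable (@snoc n @^-1` A).
  by move=> mA; rewrite -[X in measurable X]setTI; exact: measurable_snoc.
apply: measure_semi_sigma_additive.
- by move=> k; exact: mpre.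
- apply/trivIsetP => /= i j _ _ ij; rewrite -preimage_setI.
  by move/trivIsetP : tF => /(_ _ _ _ _ ij) ->//; rewrite preimage_set0.
- by rewrite -preimage_bigcup; exact: mpre.
Qed.

HB.instance Definition _ := isMeasure.Build _ _ _ snoc_measure
  snoc_measure0 snoc_measure_ge0 snoc_measure_sigma_additive.

Let snoc_measure_sigma_finite : sigma_finite setT snoc_measure.
Proof.
have /sigma_finiteP[F [TF ndF Foo]] := sigma_finiteT mu.
have /sigma_finiteP[G [TG ndG Goo]] := sigma_finiteT (@lebesgue_measure R).
exists (fun k => @unsnoc n @^-1` (F k `*` G k)).
  rewrite -preimage_bigcup -[LHS](preimage_setT (@unsnoc n)); congr (_ @^-1` _).
  rewrite -setXTT TF TG predeqE => -[x y]; split.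
    move=> [/= [i _ Fix] [k _ Gky]]; exists (maxn i k) => //; split.
    - by move: x Fix; exact/subsetPset/ndF/leq_maxl.
    - by move: y Gky; exact/subsetPset/ndG/leq_maxr.
  by move=> [i _ []/= ? ?]; split; exists i.
move=> k; have [mF Fk] := Foo k; have [mG Gk] := Goo k.
split.
  rewrite -[X in measurable X]setTI; apply: measurable_unsnoc => //.
  exact: measurableX.
rewrite /snoc_measure /pushforward -comp_preimage.
rewrite (_ : _ \o _ = id); last exact/funext/snocK.
by rewrite preimage_id product_measure1E// lte_mul_pinfty// ge0_fin_numE.
Qed.

HB.instance Definition _ := Measure_isSigmaFinite.Build _ _ _ snoc_measure
  snoc_measure_sigma_finite.

End step.

(* n-dimensional Lebesgue measure *)
Fixpoint lebesgue_rV n : {sigma_finite_measure set 'rV[R]_n -> \bar R} :=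
  if n is m.+1 then snoc_measure (lebesgue_rV m) else \d_(0 : 'rV[R]_0).

End lebesgue_rV.

(* Points (x, t) with x in R^n; measurableTypeR R is R, seen as the measurable
   type on which lebesgue_measure lives.                                      *)
Notation space_time R n := ('rV[R]_n * measurableTypeR R)%type.

Definition lebesgue_st {R : realType} n :
    {measure set (space_time R n) -> \bar R} :=
  (lebesgue_rV n \x @lebesgue_measure R)%E.

(* Euclidean norm of a vector, Frobenius norm of a matrix; the library's `|x|
   is the sup norm.                                                           *)
Definition enorm {R : realType} m n (A : 'M[R]_(m, n)) : R :=
  Num.sqrt (\sum_i \sum_j A i j ^+ 2).

Section Lebesgue_spaces.
Context {R : realType} {disp : measure_display} {T : measurableType disp}.
Variable mu : {measure set T -> \bar R}.

(* the L^p(D) norm *)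
Definition Lp_norm (p : R) (D : set T) (f : T -> R) : \bar R :=
  'N[mu]_(p%:E)[(EFin \o f) \_ D]%E.

Definition in_L2 (D : set T) (f : T -> R) : Prop :=
  measurable_fun D f /\ (Lp_norm 2 D f < +oo)%E.

End Lebesgue_spaces.

Section weak_derivatives.
Context {R : realType} {n : nat}.
Local Notation ST := (space_time R n).
Local Notation mu := (@lebesgue_st R n).
Implicit Types (Omega K : set ST) (f g phi : ST -> R) (v : ST).

(* functions of class C^k on the whole space-time *)
Fixpoint class_C (k : nat) f : Prop :=
  continuous f /\
  if k is k'.+1 then
    forall v, (forall z, derivable f z v) /\ class_C k' ('D_v f)
  else True.

(* the elements of C_c^oo(Omega), extended by zero *)
Definition test_function Omega phi : Prop :=
  (forall k, class_C k phi) /\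
  exists K, [/\ compact K, K `<=` Omega & forall z, ~ K z -> phi z = 0].

Definition loc_integrable Omega f : Prop :=
  measurable_fun Omega f /\
  forall K, compact K -> K `<=` Omega -> mu.-integrable K (EFin \o f).

(* g is the distributional derivative of f on the open set Omega along v *)
Definition weak_derivative Omega v f g : Prop :=
  [/\ loc_integrable Omega f, loc_integrable Omega g &
   forall phi, test_function Omega phi ->
     \int[mu]_(z in Omega) (f z * 'D_v phi z) =
     - \int[mu]_(z in Omega) (g z * phi z)].

Definition space_dir (i : 'I_n) : ST := (delta_mx ord0 i, 0).
Definition time_dir : ST := (0, 1).

End weak_derivatives.

(* The space dimension is d.+1; x_n is the coordinate of index ord_max and d is
   the dimension of x'.                                                       *)
Section half_cylinders.
Context {R : realType} {d : nat}.
Local Notation ST := (space_time R d.+1).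
Local Notation mu := (@lebesgue_st R d.+1).

Definition half_ball (r : R) : set 'rV[R]_d.+1 :=
  [set x | enorm x < r /\ 0 < x ord0 ord_max].

Definition Q1 : set ST := half_ball 1 `*` `]0, 1[.
Definition Q12 : set ST := half_ball 2^-1 `*` `](3 / 4), 1[.

(* Sigma, parametrized by (x', t) *)
Definition flat_point (y : space_time R d) : ST := (snoc (y.1, 0), y.2).
Definition Sigma : set (space_time R d) :=
  [set y | enorm (flat_point y).1 < 1 /\ 0 < y.2 < 1].

(* f belongs to W^{2,1}_2(Q_1^+) with spatial gradient Df, Hessian D2f and time
   derivative ft                                                              *)
Definition W212 (f : ST -> R) (Df : 'I_d.+1 -> ST -> R)
    (D2f : 'I_d.+1 -> 'I_d.+1 -> ST -> R) (ft : ST -> R) : Prop :=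
  [/\ in_L2 mu Q1 f,
      forall i, in_L2 mu Q1 (Df i) /\ weak_derivative Q1 (space_dir i) f (Df i),
      forall i j, in_L2 mu Q1 (D2f i j) /\
        weak_derivative Q1 (space_dir j) (Df i) (D2f i j) &
      in_L2 mu Q1 ft /\ weak_derivative Q1 time_dir f ft].

(* The trace operator H^1(Q_1^+) -> L^2(Sigma) is the continuous extension of
   the restriction to Sigma of functions that are C^1 up to the boundary: g is
   the trace of f iff some h_k, C^1 on R^{d+1} x R, converge to f in H^1(Q_1^+)
   while their restrictions converge to g in L^2(Sigma).                      *)
Definition has_trace (f : ST -> R) (g : space_time R d -> R) : Prop :=
  exists (Df : 'I_d.+1 -> ST -> R) (ft : ST -> R) (h : nat -> ST -> R),
    [/\ forall i, weak_derivative Q1 (space_dir i) f (Df i),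
        weak_derivative Q1 time_dir f ft &
        forall k, class_C 1 (h k)] /\
    [/\ (fun k => Lp_norm mu 2 Q1 (h k \- f)) @ \oo --> 0%E,
        forall i, (fun k => Lp_norm mu 2 Q1 ('D_(space_dir i) (h k) \- Df i))
          @ \oo --> 0%E,
        (fun k => Lp_norm mu 2 Q1 ('D_time_dir (h k) \- ft)) @ \oo --> 0%E &
        (fun k => Lp_norm (lebesgue_st d) 2 Sigma ((h k \o flat_point) \- g))
          @ \oo --> 0%E].

(* G z i j = D_{x_j} w_i (z) *)
Definition weak_gradient (w : ST -> 'rV[R]_d.+1) (G : ST -> 'M[R]_d.+1) : Prop :=
  forall i j, weak_derivative Q1 (space_dir j)
    (fun z => w z ord0 i) (fun z => G z i j).

(* regular solutions of w_t - Delta w + grad p = F, div w = 0 in Q_1^+ and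
   w = 0 on Sigma                                                             *)
Definition regular_solution (w : ST -> 'rV[R]_d.+1) (p : ST -> R)
    (F : 'I_d.+1 -> ST -> R) : Prop :=
  exists (Dw : 'I_d.+1 -> 'I_d.+1 -> ST -> R)
         (D2w : 'I_d.+1 -> 'I_d.+1 -> 'I_d.+1 -> ST -> R)
         (wt : 'I_d.+1 -> ST -> R) (Dp : 'I_d.+1 -> ST -> R),
    [/\ forall i, W212 (fun z => w z ord0 i) (Dw i) (D2w i) (wt i),
        forall i, in_L2 mu Q1 (Dp i) /\
          weak_derivative Q1 (space_dir i) p (Dp i),
        {ae mu, forall z, Q1 z -> forall i,
          wt i z - \sum_j D2w i j j z + Dp i z = F i z},
        {ae mu, forall z, Q1 z -> \sum_i Dw i i z = 0} &
        forall i, has_trace (fun z => w z ord0 i) (fun=> 0)].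

Definition stokes_solution (w : ST -> 'rV[R]_d.+1) (p : ST -> R) : Prop :=
  regular_solution w p (fun _ _ => 0).

(* T i j = D_{x_j} (u_i u_j) *)
Definition navier_stokes_solution (u : ST -> 'rV[R]_d.+1) (p : ST -> R) : Prop :=
  exists2 T : 'I_d.+1 -> 'I_d.+1 -> ST -> R,
    forall i j, weak_derivative Q1 (space_dir j)
      (fun z => u z ord0 i * u z ord0 j) (T i j) &
    regular_solution u p (fun i z => - \sum_j T i j z).

(* L^p(D) norm of a vector- or matrix-valued function *)
Definition Lp_enorm (p : R) (D : set ST) m k (f : ST -> 'M[R]_(m, k)) : \bar R :=
  Lp_norm mu p D (fun z => enorm (f z)).

End half_cylinders.

(* Main.v *)
Require Import Defs.
From HB Require Import structures.
From mathcomp Require Import all_boot all_order all_algebra.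
From mathcomp Require Import all_classical all_reals all_analysis.
From mathcomp Require Import measurable_realfun.
From mathcomp Require Import ring lra.

Set Implicit Arguments.
Unset Strict Implicit.
Unset Printing Implicit Defensive.

Import Order.TTheory GRing.Theory Num.Theory.
Import numFieldNormedType.Exports.

Local Open Scope classical_set_scope.
Local Open Scope ring_scope.

(** A parallel flow along the wall refutes both estimates. Let
      v(x_n, t) = A exp(mu^2 (t - 1)) (1 - exp(- mu x_n)),
    w = (v, 0, ..., 0) and pi = - A mu^2 x_1 exp(mu^2 (t - 1)).
    The summand exp(mu^2 (t - 1) - mu x_n) solves the heat equation, so
    v_t - v_{x_n x_n} is a function of t alone, which a pressure linear in x_1
    balances; w is divergence free and vanishes for x_n = 0. Since w points in
    direction 1 and does not depend on x_1, div (w (x) w) = 0, and the pair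
    (w, pi) solves the Stokes and the Navier-Stokes equations at once
    ([shear_stokes], [shear_navier_stokes]). The pressure is not controlled by
    w, which is what allows the growth in time to be fast.

    The flow is concentrated on a time interval of length mu^-2 before t = 1, its
    gradient moreover in the layer of thickness mu^-1 along the wall. Hence
    the integral of |w|^p over Q_1^+ is at most of order A^p / mu^2
    ([Lp_shear_velocity]), while that of |D w|^2 over Q_{1/2}^+ is at
    least of order (A mu)^2 mu^-1 mu^-2 = A^2 / mu ([Lp_shear_gradient]). With
    A = m^2 and mu = m^3 the first is bounded for p = 2 and p = 3, and the
    second grows like m.

    All functions involved are smooth on the whole of space-time, so regularity
    reduces to the statement that classical derivatives are weak derivatives
    ([weak_derivative_smooth]). That rests on the vanishing of the integral of a
    directional derivative of a compactly supported function
    ([integral_derive0]), which follows from the translation invariance of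
    Lebesgue measure ([lebesgue_st_translation]). *)

(** * Borel measurability on space-time *)

Section Borel.
Context {R : realType} {n : nat}.
Local Notation ST := (space_time R n).

Definition box (c : ST) (r : R) : set ST :=
  [set z : ST | (forall i, `|z.1 ord0 i - c.1 ord0 i| < r) /\ `|z.2 - c.2| < r].

Definition cube (r : R) : set 'rV[R]_n :=
  [set x | forall i, `|x ord0 i| < r].

Lemma measurable_cube_at (a : 'I_n -> R) (r : R) :
  measurable [set x : 'rV[R]_n | forall i, `|x ord0 i - a i| < r].
Proof.
rewrite (_ : [set _ | _] = \bigcap_(i in [set: 'I_n])
    ((fun x : 'rV[R]_n => x ord0 i) @^-1` `]a i - r, a i + r[)); last first.
  apply/seteqP; split=> x /= h i.
    by move=> _; have := h i; rewrite /= in_itv/= distrC ltr_distlC.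
  by have := h i I; rewrite /= in_itv/= distrC ltr_distlC.
apply: fin_bigcap_measurable => // i _.
by rewrite -[X in measurable X]setTI; exact: (measurable_coord i).
Qed.

Lemma measurable_cube r : measurable (cube r).
Proof.
rewrite (_ : cube r = [set x | forall i, `|x ord0 i - (fun=> 0) i| < r]).
  exact: measurable_cube_at.
by apply/seteqP; split => x /= + i => /(_ i); rewrite subr0.
Qed.

Lemma measurable_box c r : measurable (box c r).
Proof.
rewrite (_ : box c r = [set x : 'rV[R]_n | forall i, `|x ord0 i - c.1 ord0 i| < r] `*`
    `]c.2 - r, c.2 + r[%classic).
  by apply: measurableX; [exact: measurable_cube_at|exact: measurable_itv].
apply/seteqP; split => -[x t] [/= xc]; rewrite /= in_itv/= -ltr_distlC distrC//.
Qed.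

Lemma box_ball (z : ST) r : 0 < r -> box z r `<=` ball z r.
Proof.
move=> r0 [x t] [/= xz tz]; split; last by rewrite /ball/= distrC.
by split => // i j; rewrite (ord1 i) /ball/= distrC; exact: xz.
Qed.

(** The sigma-algebra is generated by the coordinates; that it contains the open
    sets is due to second countability: an open set is the union of the boxes
    with rational centre and radius 1/(k+1) that it contains. *)
Lemma open_measurable_st (O : set ST) : open O -> measurable O.
Proof.
move=> oO.
pose q (u : 'rV[rat]_n * rat * nat) : ST := (map_mx ratr u.1.1, ratr u.1.2).
pose B u := if pselect (box (q u) u.2.+1%:R^-1 `<=` O)
            then box (q u) u.2.+1%:R^-1 else set0.
have -> : O = \bigcup_(u in [set: 'rV[rat]_n * rat * nat]) B u.
  apply/seteqP; split; last first.
    by move=> z [u _]; rewrite /B; case: pselect => [uO|_ []]; exact: uO.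
  move=> z Oz; have /nbhs_ballP[e /= e0 zeO] : nbhs z O by exact: open_nbhs_nbhs.
  have [k ke] : exists k : nat, k.+1%:R^-1 < e / 2 :> R.
    have e20 : 0 < e / 2 by rewrite divr_gt0.
    have [N _ /(_ N)/(_ (leqnn _)) ?] := near_infty_natSinv_lt (PosNum e20).
    by exists N.
  have /choice[x xP] : forall i : 'I_n, exists x : rat,
      `|z.1 ord0 i - ratr x| < k.+1%:R^-1.
    move=> i; have := @rat_in_itvoo R (z.1 ord0 i - k.+1%:R^-1) (z.1 ord0 i + k.+1%:R^-1).
    case; first by rewrite ltrBlDr -addrA ltrDl addr_gt0.
    by move=> y; rewrite in_itv/= -ltr_distlC => ?; exists y.
  have [t tP] : exists t : rat, `|z.2 - ratr t| < k.+1%:R^-1.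
    have := @rat_in_itvoo R (z.2 - k.+1%:R^-1) (z.2 + k.+1%:R^-1).
    case; first by rewrite ltrBlDr -addrA ltrDl addr_gt0.
    by move=> y; rewrite in_itv/= -ltr_distlC => ?; exists y.
  have half (a b c : R) : `|a - c| < k.+1%:R^-1 -> `|b - c| < k.+1%:R^-1 ->
      `|a - b| < e.
    rewrite [e]splitr => ac bc; rewrite (le_lt_trans (ler_distD c a b))//.
    by rewrite (distrC c b) ltrD// (lt_trans _ ke).
  exists (\row_i x i, t, k) => //; rewrite /B; case: pselect => [_|[]] /=.
    by split => //= i; rewrite !mxE.
  move=> y [/= y1 y2]; apply: zeO; apply: box_ball => //; split => [i|].
    by have := y1 i; rewrite !mxE => yi; exact: (half _ _ _ yi (xP i)).
  exact: (half _ _ _ y2 tP).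
apply: countable_bigcupT_measurable => // u.
by rewrite /B; case: pselect => ?; [exact: measurable_box|exact: measurable0].
Qed.

Lemma closed_measurable_st (C : set ST) : closed C -> measurable C.
Proof.
move=> cC; rewrite -(setCK C); apply: measurableC; apply: open_measurable_st.
exact: closed_openC.
Qed.

Lemma continuous_measurable_st (f : ST -> R) :
  continuous f -> measurable_fun [set: ST] f.
Proof.
move=> /continuousP cf; apply: (measurability _ (RGenOpens.measurableE R)).
move=> _ [_ [a [b ->]] <-]; rewrite setTI.
by apply: open_measurable_st; apply: cf; exact: interval_open.
Qed.

End Borel.
Arguments cube {R} n r.

(** * Translation invariance of Lebesgue measure *)

Section translation_invariance.
Local Open Scope ereal_scope.

Definition measure_preserving {d} {T : measurableType d} {R : realType}
    (mu : set T -> \bar R) (f : T -> T) :=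
  forall A, measurable A -> mu (f @^-1` A) = mu A.

(** The image measure agrees with the product measure on rectangles, which
    determine the latter. *)
Lemma measure_preserving_prod d1 d2 (T1 : measurableType d1)
    (T2 : measurableType d2) (R : realType)
    (m1 : {sigma_finite_measure set T1 -> \bar R})
    (m2 : {sigma_finite_measure set T2 -> \bar R}) (f : T1 -> T1) (g : T2 -> T2) :
  measurable_fun setT f -> measurable_fun setT g ->
  measure_preserving m1 f -> measure_preserving m2 g ->
  measure_preserving (m1 \x m2) (fun z => (f z.1, g z.2)).
Proof.
move=> mf mg pf pg A mA.
have mfg : measurable_fun setT (fun z : T1 * T2 => (f z.1, g z.2)).
  apply: measurable_fun_pair.
    exact: (measurableT_comp mf measurable_fst).
  exact: (measurableT_comp mg measurable_snd).
apply/esym; rewrite (@product_measure_unique _ _ _ _ _ m1 m2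
  (pushforward (m1 \x m2) (fun z => (f z.1, g z.2))))// => B C mB mC.
transitivity ((m1 \x m2) ((f @^-1` B) `*` (g @^-1` C))) => //.
have mpre (d' : measure_display) (T : measurableType d') (k : T -> T) (D : set T) :
    measurable_fun setT k -> measurable D -> measurable (k @^-1` D).
  by move=> mk mD; rewrite -[X in measurable X]setTI; exact: mk.
rewrite product_measure1E; [|exact: mpre|exact: mpre].
by congr (_ * _); [exact: pf|exact: pg].
Qed.

Lemma measure_preserving_integral d (T : measurableType d) (R : realType)
    (mu : {measure set T -> \bar R}) (phi : T -> T) (f : T -> R) :
  measurable_fun setT phi -> measure_preserving mu phi ->
  measurable_fun setT f -> mu.-integrable setT (EFin \o f) ->
  mu.-integrable setT (EFin \o (f \o phi)) /\
  \int[mu]_z (f (phi z))%:E = \int[mu]_z (f z)%:E.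
Proof.
move=> mphi pphi mf intf.
have muE (F : T -> \bar R) : \int[pushforward mu phi]_y F y = \int[mu]_y F y.
  apply: (eq_measure_integral mu) => A mA _; exact: pphi.
have mEf : measurable_fun setT (EFin \o f) by exact/measurable_EFinP.
have intfphi : mu.-integrable setT (EFin \o (f \o phi)).
  apply/integrableP; split; first by apply/measurable_EFinP; exact: measurableT_comp.
  have /integrableP[_] := intf; apply: le_lt_trans.
  have := @ge0_integral_pushforward _ _ _ _ R _ mphi mu setT
    (fun z => `|(EFin \o f) z|) measurableT.
  by rewrite muE preimage_setT => <- //; exact: measurableT_comp.
split => //.
have := @integral_pushforward _ _ _ _ R _ mphi mu setT (EFin \o f) mEf.
by rewrite muE preimage_setT => <-.
Qed.

Context {R : realType}.

Lemma measurable_addr (a : R) :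
  measurable_fun [set: measurableTypeR R] (fun x : measurableTypeR R => (x + a)%R : measurableTypeR R).
Proof. exact: (measurable_funD (@measurable_id _ R setT) (measurable_cst a)). Qed.

Lemma lebesgue_measure_translation (a : R) :
  measure_preserving (@lebesgue_measure R) (fun x => (x + a)%R).
Proof.
move=> A mA.
apply/esym; rewrite (@lebesgue_measure_unique R (pushforward (@lebesgue_measure R)
  (fun x => (x + a)%R : measurableTypeR R)))//; first exact: measurable_addr.
move=> ? _ [[u v]] _ <-.
transitivity (@lebesgue_measure R `]u - a, v - a]%classic)%R; last first.
  rewrite /= /pushforward; congr (_ _).
  by apply/seteqP; split => x /=; rewrite !in_itv/= ltrBlDr lerBrDr.
rewrite /= !lebesgue_measure_itv/= !lte_fin ltrD2r.
by case: ifP => // _; rewrite -!EFinB opprD opprK addrACA addNr addr0.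
Qed.

Lemma measurable_addv n (h : 'rV[R]_n) :
  measurable_fun [set: 'rV[R]_n] (fun x : 'rV[R]_n => (x + h)%R).
Proof.
apply: measurable_fun_coordP => i; under eq_fun do rewrite mxE.
exact: (measurable_funD (measurable_coord i) (measurable_cst _)).
Qed.

(** [lebesgue_rV] adds one coordinate at a time: through [snoc], a translation of
    R^(n+1) is the product of a translation of R^n and one of R. *)
Lemma lebesgue_rV_translation n (h : 'rV[R]_n) :
  measure_preserving (lebesgue_rV n) (fun x => (x + h)%R).
Proof.
elim: n h => [|n IHn] h A mA.
  by congr (_ _); apply/seteqP; split => x /=; rewrite !(thinmx0 x) !thinmx0.
pose sh (z : 'rV[R]_n * measurableTypeR R) : 'rV[R]_n * measurableTypeR R :=
  (z.1 + (unsnoc h).1, z.2 + (unsnoc h).2)%R.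
have snocD z : snoc (sh z) = (snoc z + h)%R.
  by apply/rowP => i; rewrite !mxE; case: unliftP => [j ->|->]/=; rewrite ?mxE.
transitivity ((lebesgue_rV n \x @lebesgue_measure R)
    (sh @^-1` (@snoc R n @^-1` A))).
  rewrite /= /snoc_measure /pushforward; congr (_ _).
  by apply/seteqP; split => z; rewrite /preimage/= snocD.
apply: (@measure_preserving_prod _ _ _ _ R (lebesgue_rV n) (@lebesgue_measure R)
  (fun x => x + (unsnoc h).1)%R (fun t => t + (unsnoc h).2)%R).
- exact: measurable_addv.
- exact: measurable_addr.
- exact: IHn.
- exact: lebesgue_measure_translation.
- by rewrite -[X in measurable X]setTI; exact: measurable_snoc.
Qed.

Lemma lebesgue_st_translation n (h : space_time R n) :
  measure_preserving (lebesgue_st n) (fun z => (z + h)%R).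
Proof.
apply: (@measure_preserving_prod _ _ _ _ R (lebesgue_rV n) (@lebesgue_measure R)
  (fun x => x + h.1)%R (fun t => t + h.2)%R).
- exact: measurable_addv.
- exact: measurable_addr.
- exact: lebesgue_rV_translation.
- exact: lebesgue_measure_translation.
Qed.

Lemma lebesgue_rV_cube n (r : R) : (0 < r)%R ->
  lebesgue_rV n (cube n r) = ((r *+ 2) ^+ n)%:E.
Proof.
move=> r0; elim: n => [|n IHn].
  by rewrite /= /dirac/= indicE mem_set// => -[].
rewrite /= /snoc_measure /pushforward.
rewrite (_ : _ @^-1` _ = cube n r `*` `](- r)%R, r[%classic); last first.
  apply/seteqP; split => -[x t]/=.
    move=> xr; split => [i|].
      by have := xr (lift ord_max i); rewrite mxE liftK.
    by have := xr ord_max; rewrite mxE unlift_none/= in_itv/= ltr_norml.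
  move=> [xr]; rewrite in_itv/= -ltr_norml => tr i.
  by rewrite mxE; case: unliftP => [j|] _ /=.
transitivity (((r *+ 2) ^+ n)%:E * lebesgue_measure (`](- r)%R, r[%classic)).
  by rewrite -IHn; apply: product_measure1E => //; exact: measurable_cube.
rewrite lebesgue_measure_itv/= lte_fin gtrN// -EFinB -EFinM opprK.
by rewrite exprSr mulr2n.
Qed.

End translation_invariance.

(** * The integral of a directional derivative *)

Section integral_of_derivative.
Context {R : realType} {n : nat}.
Local Notation ST := (space_time R n).
Local Notation mu := (@lebesgue_st R n).

Lemma lebesgue_st_box (r : R) : 0 < r ->
  mu (box 0 r) = ((r *+ 2) ^+ n.+1)%:E.
Proof.
move=> r0.
have -> : box (0 : ST) r = cube n r `*` `](- r)%R, r[%classic.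
  apply/seteqP; split => -[x t] /= [xr].
    rewrite subr0 in_itv/= -ltr_norml => tr; split => // i.
    by have := xr i; rewrite mxE subr0.
  rewrite in_itv/= -ltr_norml /box/= => tr; rewrite subr0.
  by split=> // i; rewrite mxE subr0.
transitivity (((r *+ 2) ^+ n)%:E * lebesgue_measure (`](- r)%R, r[%classic))%E.
  rewrite -lebesgue_rV_cube//; apply: product_measure1E => //.
  exact: measurable_cube.
rewrite lebesgue_measure_itv/= lte_fin gtrN// -EFinB -EFinM opprK.
by rewrite exprSr mulr2n.
Qed.

Lemma norm_box (r : R) (z : ST) : 0 < r -> `|z| < r -> box 0 r z.
Proof.
move=> r0; rewrite [`|z|]/Num.norm/= gt_max => /andP[z1 z2]; split => [i|].
  rewrite mxE subr0 (le_lt_trans _ z1)// [leRHS]mx_normrE.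
  exact: (le_bigmax _ (fun k : 'I_1 * 'I_n => `|z.1 k.1 k.2|) (ord0, i)).
by rewrite subr0.
Qed.

Lemma integral_translation (f : ST -> R) (h : ST) :
  measurable_fun setT f -> mu.-integrable setT (EFin \o f) ->
  mu.-integrable setT (fun z => (f (z + h))%:E) /\
  (\int[mu]_z (f (z + h))%:E = \int[mu]_z (f z)%:E)%E.
Proof.
move=> mf intf.
apply: (measure_preserving_integral (phi := fun z : ST => z + h) _ _ mf intf).
  apply: measurable_fun_pair.
    exact: (measurableT_comp (measurable_addv h.1) measurable_fst).
  exact: (measurableT_comp (measurable_addr h.2) measurable_snd).
exact: lebesgue_st_translation.
Qed.

Lemma is_derive_line (f : ST -> R) (z v : ST) (h : R) :
  derivable f (h *: v + z) v ->
  is_derive h 1 (fun s : R => f (s *: v + z)) ('D_v f (h *: v + z)).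
Proof.
move=> df.
have E : (fun s : R => s^-1 *: (((fun s : R => f (s *: v + z)) \o shift h) (s *: (1 : R^o))
     - f (h *: v + z))) =
   (fun s => s^-1 *: ((f \o shift (h *: v + z)) (s *: v) - f (h *: v + z))).
  apply/funext => s /=; congr (_ *: (f _ - _)).
  by rewrite scalerDl addrA; rewrite /GRing.scale/= mulr1.
by apply: DeriveDef; rewrite /derivable /derive E.
Qed.

(** The mean value inequality, applied to [f] along a line. *)
Lemma le_derive_line (f : ST -> R) (z v : ST) (M h : R) :
  (forall y, derivable f y v) -> (forall y, `|'D_v f y| <= M) ->
  0 <= h -> `|f (h *: v + z) - f z| <= M * h.
Proof.
move=> df DM h0.
have dl (s : R) : is_derive s 1 (fun s : R => f (s *: v + z)) ('D_v f (s *: v + z)).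
  exact: is_derive_line.
have := @MVT_segment R (fun s : R => f (s *: v + z)) _ 0 h h0 (fun s _ => dl s).
case.
  apply: derivable_within_continuous => s _; exact: ex_derive.
move=> c _; rewrite scale0r add0r subr0 => ->.
by rewrite normrM (ger0_norm h0) ler_wpM2r.
Qed.

Lemma integrable_box (f : ST -> R) (r M : R) : 0 < r ->
  measurable_fun setT f -> (forall z, `|f z| <= M) ->
  (forall z, ~ box 0 r z -> f z = 0) -> mu.-integrable setT (EFin \o f).
Proof.
move=> r0 mf fM f0.
rewrite (_ : EFin \o f = (EFin \o f) \_ (box 0 r)); last first.
  apply/funext => z; rewrite /restrict; case: ifPn => //.
  by rewrite notin_setE => /f0 /= ->.
apply/(integrable_mkcond _ (measurable_box _ _)).
apply: measurable_bounded_integrable.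
- exact: measurable_box.
- by rewrite lebesgue_st_box// ltry.
- exact: measurable_funTS.
- exists M; split; first exact: num_real.
  by move=> x Mx z _ /=; exact: le_trans (fM z) (ltW Mx).
Qed.

Lemma compact_normlt (K : set ST) : compact K ->
  exists2 r : R, 0 < r & forall z, K z -> `|z| < r.
Proof.
move=> /compact_bounded[r [_ Kr]].
exists (Num.max r 0 + 2); first by rewrite ltr_wpDl// le_max lexx orbT.
move=> z Kz.
have /Kr/(_ z Kz) : r < Num.max r 0 + 1.
  by rewrite ltr_pwDr// le_max lexx.
by move=> /= /le_lt_trans; apply; rewrite ltrD2l ltrDl.
Qed.

(** The complement of [K] is open, so [f] vanishes near [z]. *)
Lemma derive_outside (K : set ST) (f : ST -> R) (v z : ST) :
  compact K -> (forall z, ~ K z -> f z = 0) -> ~ K z -> 'D_v f z = 0.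
Proof.
move=> cK f0 Kz; rewrite (near_eq_derive _ (g := cst 0)) ?derive_cst//.
have oK : open (~` K).
  by apply: closed_openC; apply: compact_closed => //; exact: norm_hausdorff.
by near=> y; apply: f0; near: y; exact: open_nbhs_nbhs.
Unshelve. all: by end_near. Qed.

Lemma compact_support_bounded (K : set ST) (f : ST -> R) :
  compact K -> continuous f -> (forall z, ~ K z -> f z = 0) ->
  exists M, forall z, `|f z| <= M.
Proof.
move=> cK cf f0.
have /compact_bounded[M [_ fM]] : compact (f @` K).
  by apply: continuous_compact => //; exact: continuous_subspaceT.
exists (Num.max M 0 + 1) => z; have [Kz|/f0 ->] := pselect (K z).
  by apply: fM; [rewrite ltr_pwDr// le_max lexx|exists z].
by rewrite normr0 addr_ge0// le_max lexx orbT.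
Qed.

(** By translation invariance the difference quotients of [f] along [v] have
    integral 0. They are bounded by the supremum of |D_v f| and vanish outside a
    fixed box, so dominated convergence passes to the limit. Unlike an iterated
    integral in the coordinate along [v], this treats all directions alike. *)
Lemma integral_derive0 (K : set ST) (f : ST -> R) (v : ST) :
  compact K -> (forall z, ~ K z -> f z = 0) -> continuous f ->
  (forall z, derivable f z v) -> continuous ('D_v f) ->
  mu.-integrable setT (EFin \o 'D_v f) /\ (\int[mu]_z ('D_v f z)%:E = 0)%E.
Proof.
move=> cK f0 cf df cDf.
have Df0 z : ~ K z -> 'D_v f z = 0 by exact: derive_outside.
have [M fM] := compact_support_bounded cK cf f0.
have [N DfN] := compact_support_bounded cK cDf Df0.
have [r r0 Kr] := compact_normlt cK.
pose q k (z : ST) := k.+1%:R * (f (k.+1%:R^-1 *: v + z) - f z).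
have mf := continuous_measurable_st cf.
have intf : mu.-integrable setT (EFin \o f).
  by apply: (integrable_box r0 mf fM) => z rz; apply: f0 => /Kr zr; apply: rz; exact: norm_box.
have tr k := integral_translation (k.+1%:R^-1 *: v) mf intf.
have intfk k : mu.-integrable setT (EFin \o (fun z => f (k.+1%:R^-1 *: v + z))).
  by have [+ _] := tr k; under eq_fun do rewrite addrC.
have q0 k : (\int[mu]_z (q k z)%:E = 0)%E.
  rewrite /q; under eq_integral do rewrite EFinM EFinB.
  rewrite integralZl//; last exact: (integrableB measurableT (intfk k) intf).
  rewrite integralB//; last exact: (intfk k).
  have [_] := tr k; under eq_integral do rewrite addrC.
  by move=> ->; rewrite subee ?mule0// integrable_fin_num.
pose r' := r + `|v| + 1.
have r'0 : 0 < r' by rewrite addr_gt0// ltr_wpDr.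
have cvgq z : q ^~ z @ \oo --> 'D_v f z.
  have H : (fun h : R => h^-1 * (f (h *: v + z) - f z)) @ 0^' --> 'D_v f z.
    exact: df z.
  have C : (fun k : nat => (k.+1%:R^-1)^-1 * (f (k.+1%:R^-1 *: v + z) - f z))
      @ \oo --> 'D_v f z.
    apply: ((cvgr_dnbhsP (fun h : R => h^-1 * (f (h *: v + z) - f z)) 0 _).1 H
      (fun k => k.+1%:R^-1)).
    by split; [move=> k; rewrite gt_eqF|exact: cvg_harmonic].
  by move: C; under eq_fun do rewrite invrK.
have qz k z : ~ box 0 r' z -> q k z = 0.
  move=> r'z; rewrite /q !f0 ?subrr ?mulr0// => /Kr rz; apply: r'z;
    apply: norm_box => //.
    by rewrite /r' (lt_trans rz)// -addrA ltrDl ltr_wpDl.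
  rewrite -[z](addKr (k.+1%:R^-1 *: v)) addrC (le_lt_trans (ler_normB _ _))//.
  rewrite /r' -addrA ltr_leD// normrZ ger0_norm//.
  by rewrite (le_trans (ler_piMl _ _))// ?invf_le1 ?ler1n// lerDl.
have qN k z : `|q k z| <= N.
  rewrite normrM ger0_norm// mulrC -ler_pdivlMr//.
  exact: le_derive_line.
have mq k : @measurable_fun _ _ ST R setT (q k).
  apply: measurable_funM => //; apply: measurable_funB => //.
  by have /measurable_int/measurable_EFinP := intfk k.
have N0 : 0 <= N by rewrite (le_trans _ (DfN 0)).
have intN : mu.-integrable setT (EFin \o (fun z => N * \1_(box 0 r') z)).
  apply: (@integrable_box _ r' N) => //.
  - apply: measurable_funM => //; apply: measurable_indic; exact: measurable_box.
  - move=> z; rewrite normrM ger0_norm// indicE; case: (_ \in _); first by rewrite normr1 mulr1.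
    by rewrite normr0 mulr0.
  - by move=> z rz; rewrite indicE memNset// mulr0.
have := @dominated_convergence _ _ _ mu setT measurableT
  (fun k => EFin \o q k) (EFin \o 'D_v f)
  (EFin \o (fun z => N * \1_(box 0 r') z)).
case.
- by move=> k; exact/measurable_EFinP.
- by apply/measurable_EFinP; exact: (continuous_measurable_st cDf).
- by apply: aeW => z _; apply/cvg_EFin => //; [exact: nearW|exact: cvgq].
- exact: intN.
- apply: aeW => z k _; rewrite /= lee_fin indicE.
  case: (pselect (box 0 r' z)) => rz; first by rewrite mem_set// mulr1.
  by rewrite memNset// mulr0 qz// normr0.
move=> intD _ C; split => //.
rewrite -(cvg_lim _ C)//; apply: lim_near_cst => //.
by apply: nearW => k; exact: q0.
Qed.

End integral_of_derivative.

(** * Weak derivatives of smooth functions *)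

Section weak_derivatives_of_smooth_functions.
Context {R : realType} {n : nat}.
Local Notation ST := (space_time R n).
Local Notation mu := (@lebesgue_st R n).

Lemma integrable_compact_support (K : set ST) (f : ST -> R) :
  compact K -> continuous f -> (forall z, ~ K z -> f z = 0) ->
  mu.-integrable setT (EFin \o f).
Proof.
move=> cK cf f0; have [M fM] := compact_support_bounded cK cf f0.
have [r r0 Kr] := compact_normlt cK.
apply: (integrable_box r0 (continuous_measurable_st cf) fM) => z rz.
by apply: f0 => /Kr zr; apply: rz; exact: norm_box.
Qed.

Lemma continuous_loc_integrable (Omega : set ST) (f : ST -> R) :
  continuous f -> loc_integrable Omega f.
Proof.
move=> cf; split; first by apply: measurable_funTS; exact: continuous_measurable_st.
move=> K cK _; have [r r0 Kr] := compact_normlt cK.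
have mK : measurable K.
  by apply: closed_measurable_st; apply: compact_closed => //; exact: norm_hausdorff.
apply: measurable_bounded_integrable => //.
- apply: (@le_lt_trans _ _ (mu (box 0 r))).
    apply: le_measure; rewrite ?inE//; first exact: measurable_box.
    by move=> z /Kr; exact: norm_box.
  by rewrite lebesgue_st_box// ltry.
- by apply: measurable_funTS; exact: continuous_measurable_st.
- have /compact_bounded[M [Mr fM]] : compact (f @` K).
    by apply: continuous_compact => //; exact: continuous_subspaceT.
  by exists M; split => // x Mx z Kz; apply: fM => //; exists z.
Qed.

(** For a test function phi supported in [Omega], the integral of D_v (f phi)
    over the whole space is 0, and by the product rule it is the sum of the two
    integrals to be compared. *)
Lemma weak_derivative_smooth (Omega : set ST) (v : ST) (f g : ST -> R) :
  continuous f -> continuous g -> (forall z, is_derive z v f (g z)) ->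
  weak_derivative Omega v f g.
Proof.
move=> cf cg dfg; split; [exact: continuous_loc_integrable..|].
move=> phi [phiC [K [cK KO phi0]]].
have [cphi /(_ v)[dphi [cDphi _]]] := phiC 1%N.
have Dphi0 z : ~ K z -> 'D_v phi z = 0 by exact: derive_outside.
have cM (a b : ST -> R) : continuous a -> continuous b ->
    continuous (fun z => a z * b z).
  by move=> ca cb z; apply: cvgM; [exact: ca|exact: cb].
have i1 : mu.-integrable setT (EFin \o (fun z => f z * 'D_v phi z)).
  apply: (integrable_compact_support cK); first exact: cM.
  by move=> z /Dphi0 ->; rewrite mulr0.
have i2 : mu.-integrable setT (EFin \o (fun z => g z * phi z)).
  apply: (integrable_compact_support cK); first exact: cM.
  by move=> z /phi0 ->; rewrite mulr0.
have toT (h : ST -> R) : (forall z, ~ K z -> h z = 0) ->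
    \int[mu]_(z in Omega) h z = \int[mu]_z h z.
  move=> h0; rewrite Rintegral_mkcond; congr Rintegral; apply/funext => z.
  rewrite /restrict; case: ifPn => //; rewrite notin_setE => Oz.
  by rewrite h0// => /KO.
rewrite !toT; last 2 first.
- by move=> z /phi0 ->; rewrite mulr0.
- by move=> z /Dphi0 ->; rewrite mulr0.
apply/eqP; rewrite -subr_eq0 opprK -RintegralD//.
have DEz z : 'D_v (fun z => f z * phi z) z = f z * 'D_v phi z + g z * phi z.
  have dz := derivableP (dphi z).
  rewrite (@derive_val _ _ _ _ _ _ _ (is_deriveM (dfg z) dz)).
  by rewrite /GRing.scale/= (mulrC (phi z)).
have DE : 'D_v (fun z => f z * phi z) = (fun z => f z * 'D_v phi z + g z * phi z).
  by apply/funext => z; exact: DEz.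
have [] := @integral_derive0 R n K (fun z => f z * phi z) v cK.
- by move=> z /phi0 ->; rewrite mulr0.
- exact: cM.
- move=> z; have dz := derivableP (dphi z).
  exact: (@ex_derive _ _ _ _ _ _ _ (is_deriveM (dfg z) dz)).
- rewrite DE => z; apply: cvgD; [exact: (cM _ _ cf cDphi)|exact: (cM _ _ cg cphi)].
move=> _ I0; rewrite /Rintegral -[X in _ == X]/(fine 0%E) -I0.
by apply/eqP; congr fine; apply: eq_integral => z _; rewrite DEz.
Qed.

(** Reduces a directional derivative of an explicit function to the derivative of
    a function of one real variable. *)
Lemma is_derive_from_line (f : ST -> R) (z v : ST) (df : R) :
  is_derive (0 : R) 1 (fun s : R => f (s *: v + z)) df -> is_derive z v f df.
Proof.
move=> [ex dE].
have E : (fun s : R => s^-1 *: (((fun s : R => f (s *: v + z)) \o shift 0) (s *: (1 : R^o))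
     - f (0 *: v + z))) =
   (fun s => s^-1 *: ((f \o shift z) (s *: v) - f z)).
  apply/funext => s /=; rewrite scale0r add0r addr0.
  by rewrite /GRing.scale/= mulr1.
by apply: DeriveDef; [move: ex|move: dE]; rewrite /derivable /derive E.
Qed.

End weak_derivatives_of_smooth_functions.

(** * Norms in L^p *)

Section Lp_norms.
Context {R : realType} {disp : measure_display} {T : measurableType disp}.
Context (mu : {measure set T -> \bar R}).
Local Open Scope ereal_scope.

Lemma Lp_normE (p : R) (D : set T) (f : T -> R) : (0 < p)%R ->
  Lp_norm mu p D f = (\int[mu]_(z in D) (`|f z| `^ p)%:E) `^ p^-1.
Proof.
move=> p0; rewrite /Lp_norm unlock [in RHS]integral_mkcond; congr (_ `^ _).
apply: eq_integral => z _; rewrite /restrict; case: ifPn => _ //.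
by rewrite abse0 poweR0r// gt_eqF.
Qed.

Lemma Lp_norm_ge0 p D f : 0 <= Lp_norm mu p D f.
Proof. exact: Lnorm_ge0. Qed.

Lemma Lp_norm_exprn (p : nat) (D : set T) (f : T -> R) : (0 < p)%N ->
  Lp_norm mu p%:R D f ^+ p = \int[mu]_(z in D) (`|f z| ^+ p)%:E.
Proof.
move=> p0; rewrite Lp_normE ?ltr0n//.
under eq_integral do rewrite powR_mulrn//.
have : 0 <= \int[mu]_(z in D) (`|f z| ^+ p)%:E.
  by apply: integral_ge0 => z _; rewrite lee_fin exprn_ge0.
case: (\int[mu]_(z in D) _) => [r r0| _ |//].
  rewrite poweR_EFin -EFin_expe -powR_mulrn ?powR_ge0// -powRrM mulVf ?powRr1//.
  by rewrite pnatr_eq0 -lt0n.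
rewrite poweRyr ?invr_eq0 ?pnatr_eq0 -?lt0n//; case: p p0 => // p _.
by elim: p => // p IHp; rewrite expeS IHp mulyy.
Qed.

Lemma Lp_norm0 (p : R) (D : set T) : (0 < p)%R -> Lp_norm mu p D (fun=> 0%R) = 0.
Proof.
move=> p0; rewrite Lp_normE//.
under eq_integral do rewrite normr0 powR0 ?gt_eqF//.
by rewrite integral0 poweR0r// invr_eq0 gt_eqF.
Qed.

Lemma bounded_in_L2 (D : set T) (f : T -> R) (M : R) :
  measurable D -> mu D < +oo -> measurable_fun D f ->
  (forall z, D z -> `|f z| <= M)%R -> in_L2 mu D f.
Proof.
move=> mD Doo mf fM; split => //.
rewrite Lp_normE//; apply: poweR_lty.
under eq_integral do rewrite powR_mulrn//.
have : mu.-integrable D (EFin \o (fun z => `|f z| ^+ 2)%R).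
  apply: measurable_bounded_integrable => //.
    by apply: measurable_funX; exact: measurableT_comp.
  exists (M ^+ 2)%R; split; first exact: num_real.
  move=> x Mx z Dz /=; rewrite (le_trans _ (ltW Mx))//.
  by rewrite ger0_norm// lerXn2r ?nnegrE ?fM// (le_trans _ (fM z Dz)).
by move=> /integrable_lty; apply.
Qed.

End Lp_norms.

(** * Functions on the half cylinder *)

Section half_cylinder.
Context {R : realType} {d : nat}.
Local Notation ST := (space_time R d.+1).
Local Notation mu := (@lebesgue_st R d.+1).

Lemma enorm_ge0 m n (A : 'M[R]_(m, n)) : 0 <= enorm A.
Proof. exact: sqrtr_ge0. Qed.

Lemma ler_enorm n (x : 'rV[R]_n) i : `|x ord0 i| <= enorm x.
Proof.
rewrite /enorm big_ord1 -sqrtr_sqr ler_wsqrtr// (bigD1 i)//= lerDl.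
by apply: sumr_ge0 => j _; exact: sqr_ge0.
Qed.

Lemma measurable_enorm n : measurable_fun [set: 'rV[R]_n] (@enorm R 1 n).
Proof.
apply: (measurableT_comp (continuous_measurable_fun (@sqrt_continuous R))).
under eq_fun do rewrite big_ord1.
apply: measurable_sum => i; apply: measurable_funX; exact: measurable_coord.
Qed.

Lemma measurable_half_ball (r : R) : measurable (@half_ball R d r).
Proof.
rewrite (_ : half_ball r = (@enorm R 1 d.+1 @^-1` `]-oo, r[) `&`
    ((fun x : 'rV[R]_d.+1 => x ord0 ord_max) @^-1` `]0, +oo[)); last first.
  by apply/seteqP; split => x /=; rewrite !in_itv/= andbT.
apply: measurableI; rewrite -[X in measurable X]setTI.
  exact: measurable_enorm.
exact: measurable_coord.
Qed.

Lemma measurable_Q1 : measurable (@Q1 R d).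
Proof. by apply: measurableX; [exact: measurable_half_ball|exact: measurable_itv]. Qed.

Lemma measurable_Q12 : measurable (@Q12 R d).
Proof. by apply: measurableX; [exact: measurable_half_ball|exact: measurable_itv]. Qed.

Lemma Q1_box : @Q1 R d `<=` box 0 2.
Proof.
move=> -[x t] [/= [x1 _]]; rewrite in_itv/= => /andP[t0 t1]; split => [i|]/=.
  rewrite mxE subr0 (le_lt_trans (ler_enorm x i))// (lt_trans x1)//.
  by rewrite ltr1n.
by rewrite subr0 gtr0_norm// (lt_trans t1)// ltr1n.
Qed.

Lemma Q1_lty : (mu Q1 < +oo)%E.
Proof.
apply: (@le_lt_trans _ _ (mu (box 0 2))); last by rewrite lebesgue_st_box// ltry.
apply: le_measure; rewrite ?inE//; [exact: measurable_Q1|exact: measurable_box|].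
exact: Q1_box.
Qed.

(** [Q1] lies in the product of the closed unit ball of the sup norm and [0, 1],
    which is compact. *)
Lemma bounded_Q1 (f : ST -> R) : continuous f ->
  exists M, forall z, Q1 z -> `|f z| <= M.
Proof.
move=> cf.
pose K : set ST := [set x : 'rV[R]_d.+1 | `|x| <= 1] `*` `[0, 1]%classic.
have cK : compact K.
  apply: compact_setX; last exact: segment_compact.
  apply: bounded_closed_compact.
    by exists 1; split => // M M1 x /= x1; rewrite (le_trans x1)// ltW.
  rewrite (_ : [set x | _] = (fun x : 'rV[R]_d.+1 => `|x|) @^-1` [set r | r <= 1])//.
  by apply: closed_comp; [move=> x _; exact: norm_continuous|exact: closed_le].
have /compact_bounded[M [_ fM]] : compact (f @` K).
  by apply: continuous_compact => //; exact: continuous_subspaceT.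
exists (M + 1) => -[x t] [/= [x1 _]]; rewrite in_itv/= => /andP[t0 t1].
apply: fM; first by rewrite ltrDl.
exists (x, t) => //; split => /=; last by rewrite in_itv/= !ltW.
rewrite [leLHS]mx_normrE; apply: bigmax_le => // -[i j] _ /=.
by rewrite (ord1 i) (le_trans (ler_enorm x j))// ltW.
Qed.

Lemma continuous_in_L2 (f : ST -> R) : continuous f -> in_L2 mu Q1 f.
Proof.
move=> cf; have [M fM] := bounded_Q1 cf.
apply: (bounded_in_L2 (M := M)) => //; [exact: measurable_Q1|exact: Q1_lty|].
by apply: measurable_funTS; exact: continuous_measurable_st.
Qed.

(** A function that is C^1 up to the boundary is the limit of the constant
    sequence, so its trace is its restriction. *)
Lemma class_C1_has_trace0 (f : ST -> R) : class_C 1 f ->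
  (forall y, f (flat_point y) = 0) -> has_trace f (fun=> 0).
Proof.
move=> [cf df] f0.
have L0 v : (fun k : nat => Lp_norm mu 2 Q1 ('D_v f \- 'D_v f)) @ \oo --> 0%E.
  rewrite (_ : _ \- _ = fun=> 0); last by apply/funext => z /=; rewrite subrr.
  by rewrite Lp_norm0//; exact: cvg_cst.
have wD v : weak_derivative Q1 v f ('D_v f).
  have [dv [cdv _]] := df v.
  by apply: weak_derivative_smooth => // z; exact: derivableP.
exists (fun i => 'D_(space_dir i) f), ('D_time_dir f), (fun=> f).
split; split => //.
- rewrite (_ : _ \- _ = fun=> 0); last by apply/funext => z /=; rewrite subrr.
  by rewrite Lp_norm0//; exact: cvg_cst.
- rewrite (_ : _ \- _ = fun=> 0); last first.
    by apply/funext => z /=; rewrite f0 subrr.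
  by rewrite Lp_norm0//; exact: cvg_cst.
Qed.

End half_cylinder.

(** * Functions of shear type *)

Section shear_functions.
Context {R : realType} {d : nat}.
Local Notation ST := (space_time R d.+1).
Context (lambda mu : R).

(** A class of functions that is stable under differentiation in all directions
    and contains the components of the velocity, the pressure and their
    derivatives. *)
Definition shear_fun (a b c : R) (z : ST) : R :=
  (a + b * z.1 ord0 ord0) * expR (lambda * (z.2 - 1)) +
  c * expR (lambda * (z.2 - 1) - mu * z.1 ord0 ord_max).

Lemma continuous_shear_fun a b c : continuous (shear_fun a b c).
Proof.
have cx (i : 'I_d.+1) : continuous (fun z : ST => z.1 ord0 i).
  move=> z; apply: (@continuous_comp _ _ _ fst (fun x : 'rV[R]_d.+1 => x ord0 i)).
    exact: cvg_fst.
  exact: coord_continuous.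
have ct : continuous (fun z : ST => lambda * (z.2 - 1)).
  move=> z; apply: cvgM; first exact: cvg_cst.
  by apply: cvgB; [exact: cvg_snd|exact: cvg_cst].
have ce (f : ST -> R) : continuous f -> continuous (fun z => expR (f z)).
  by move=> cf z; apply: continuous_comp; [exact: cf|exact: continuous_expR].
move=> z; apply: cvgD; apply: cvgM.
- by apply: cvgD; [exact: cvg_cst|apply: cvgM; [exact: cvg_cst|exact: cx]].
- exact: ce.
- exact: cvg_cst.
- apply: ce => y; apply: cvgB; first exact: ct.
  by apply: cvgM; [exact: cvg_cst|exact: cx].
Qed.

Lemma is_derive_shear_fun a b c (v z : ST) :
  is_derive z v (shear_fun a b c)
    (shear_fun (a * lambda * v.2 + b * v.1 ord0 ord0) (b * lambda * v.2)
      (c * (lambda * v.2 - mu * v.1 ord0 ord_max)) z).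
Proof.
apply: is_derive_from_line; rewrite /shear_fun/=.
under eq_fun do rewrite !mxE.
apply: is_derive_eq.
rewrite /GRing.scale/= !(mul0r, mulr0, add0r, addr0, subr0, mulr1, mul1r).
ring.
Qed.

Lemma class_C_shear_fun k a b c : class_C k (shear_fun a b c).
Proof.
elim: k a b c => [|k IHk] a b c; split => //; try exact: continuous_shear_fun.
move=> v; have dv := is_derive_shear_fun a b c v.
split=> [z|]; first exact: ex_derive.
have -> : 'D_v (shear_fun a b c) =
    shear_fun (a * lambda * v.2 + b * v.1 ord0 ord0) (b * lambda * v.2)
      (c * (lambda * v.2 - mu * v.1 ord0 ord_max)).
  by apply/funext => z; exact: derive_val.
exact: IHk.
Qed.

Lemma shear_weak_derivative Omega a b c (v : ST) :
  weak_derivative Omega v (shear_fun a b c)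
    (shear_fun (a * lambda * v.2 + b * v.1 ord0 ord0) (b * lambda * v.2)
      (c * (lambda * v.2 - mu * v.1 ord0 ord_max))).
Proof.
apply: weak_derivative_smooth; [exact: continuous_shear_fun..|].
exact: is_derive_shear_fun.
Qed.

End shear_functions.

(** * Shear flows with a boundary layer *)

Section shear_flow.
Context {R : realType} {d : nat}.
Local Notation ST := (space_time R d.+1).
Local Notation leb := (@lebesgue_st R d.+1).
Context (mu A : R).
Local Notation sf := (@shear_fun R d (mu ^+ 2) mu).

Lemma shear_fun_in_L2 a b c : in_L2 leb Q1 (sf a b c).
Proof. exact/continuous_in_L2/continuous_shear_fun. Qed.

(** A exp(mu^2 (t - 1)) (1 - exp(- mu x_n)) in direction 1. *)
Definition shear_velocity (z : ST) : 'rV[R]_d.+1 :=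
  sf A 0 (- A) z *: delta_mx ord0 ord0.

Definition shear_gradient (z : ST) : 'M[R]_d.+1 :=
  sf 0 0 (A * mu) z *: delta_mx ord0 ord_max.

Definition shear_pressure (z : ST) : R := sf 0 (- (A * mu ^+ 2)) 0 z.

Lemma shear_fun_scale (k a b c : R) z :
  k * sf a b c z = sf (k * a) (k * b) (k * c) z.
Proof. by rewrite /shear_fun; ring. Qed.

Lemma shear_velocityE i z : shear_velocity z ord0 i =
  sf ((i == ord0)%:R * A) 0 (- ((i == ord0)%:R * A)) z.
Proof.
by rewrite !mxE eqxx/= mulrC shear_fun_scale mulr0 mulrN.
Qed.

Lemma shear_gradientE i j z : shear_gradient z i j =
  sf 0 0 ((i == ord0)%:R * A * (mu * (j == ord_max)%:R)) z.
Proof.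
by rewrite !mxE mulrC shear_fun_scale !mulr0 -mulnb natrM; congr shear_fun; ring.
Qed.

Lemma space_dir1 (i j : 'I_d.+1) : (@space_dir R _ i).1 ord0 j = (j == i)%:R.
Proof. by rewrite mxE. Qed.

Lemma space_dir2 (i : 'I_d.+1) : (@space_dir R _ i).2 = 0.
Proof. by []. Qed.

Lemma shear_weak_gradient : weak_gradient shear_velocity shear_gradient.
Proof.
move=> i j; under eq_fun do rewrite shear_velocityE.
under [X in weak_derivative _ _ _ X]eq_fun do rewrite shear_gradientE.
have := @shear_weak_derivative R d (mu ^+ 2) mu Q1
  ((i == ord0)%:R * A) 0 (- ((i == ord0)%:R * A)) (space_dir j).
congr weak_derivative; apply/funext => z.
by rewrite !space_dir1 !space_dir2 /shear_fun (eq_sym (ord_max : 'I_d.+1)); ring.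
Qed.

Context (d0 : (0 < d)%N).

Let ord0_neq_max : (ord0 == ord_max :> 'I_d.+1) = false.
Proof. by apply/negP => /eqP/(congr1 val)/=; move: d0; case: d. Qed.

(** The second exponential of the velocity satisfies the heat equation because
    the rate of growth mu^2 in time is the square of the rate of decay in x_n.
    What the first one leaves, A mu^2 exp(mu^2 (t - 1)), is cancelled by the
    pressure gradient. Direction 1 is tangential to the wall because the
    dimension is at least 2. *)
Lemma shear_regular_solution (F : 'I_d.+1 -> ST -> R) :
  (forall i z, F i z = 0) ->
  regular_solution shear_velocity shear_pressure F.
Proof.
move=> F0.
pose a (i : 'I_d.+1) := (i == ord0)%:R * A.
exists (fun i j => sf 0 0 (a i * (mu * (j == ord_max)%:R))),
  (fun i j k => sf 0 0 (- (a i * (mu * (j == ord_max)%:R) * (mu * (k == ord_max)%:R)))),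
  (fun i => sf (a i * mu ^+ 2) 0 (- (a i * mu ^+ 2))),
  (fun i => sf (- (A * mu ^+ 2 * (i == ord0)%:R)) 0 0).
have vE i : (fun z => shear_velocity z ord0 i) = sf (a i) 0 (- a i).
  by apply/funext => z; rewrite shear_velocityE.
split.
- move=> i; rewrite vE; split.
  + exact: shear_fun_in_L2.
  + move=> j; split; first exact: shear_fun_in_L2.
    have := @shear_weak_derivative R d (mu ^+ 2) mu Q1 (a i) 0 (- a i) (space_dir j).
    congr weak_derivative; apply/funext => z.
    by rewrite !space_dir1 !space_dir2 /shear_fun (eq_sym (ord_max : 'I_d.+1)); ring.
  + move=> j k; split; first exact: shear_fun_in_L2.
    have := @shear_weak_derivative R d (mu ^+ 2) mu Q1 0 0
      (a i * (mu * (j == ord_max)%:R)) (space_dir k).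
    congr weak_derivative; apply/funext => z.
    by rewrite !space_dir1 !space_dir2 /shear_fun (eq_sym (ord_max : 'I_d.+1)); ring.
  + split; first exact: shear_fun_in_L2.
    have := @shear_weak_derivative R d (mu ^+ 2) mu Q1 (a i) 0 (- a i) time_dir.
    congr weak_derivative; apply/funext => z.
    by rewrite /time_dir /shear_fun !mxE/=; ring.
- move=> i; split; first exact: shear_fun_in_L2.
  have := @shear_weak_derivative R d (mu ^+ 2) mu Q1 0 (- (A * mu ^+ 2)) 0 (space_dir i).
  congr weak_derivative; apply/funext => z.
  by rewrite !space_dir1 !space_dir2 /shear_fun (eq_sym (ord0 : 'I_d.+1)); ring.
- apply: aeW => z _ i; rewrite F0.
  rewrite (bigD1 ord_max)//= big1 => [|j /negbTE jmax]; last first.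
    by rewrite jmax /shear_fun/= mulr0n; ring.
  by rewrite eqxx /a /shear_fun/= mulr1n; ring.
- apply: aeW => z _; rewrite big1// => i _.
  rewrite /a; have [->|_] := eqVneq i ord0; last first.
    by rewrite /shear_fun/= mulr0n; ring.
  by rewrite ord0_neq_max /shear_fun/= mulr0n mulr1n; ring.
- move=> i; rewrite vE; apply: class_C1_has_trace0; first exact: class_C_shear_fun.
  move=> y; rewrite /shear_fun /flat_point/= !mxE unlift_none/= mulr0 subr0.
  by ring.
Qed.

Lemma shear_stokes : stokes_solution shear_velocity shear_pressure.
Proof. exact: shear_regular_solution. Qed.

(** Only u_1 u_1 is different from 0, and its derivative along x_1 vanishes: the
    convective term is 0 and the equations are those of Stokes. *)
Lemma shear_navier_stokes : navier_stokes_solution shear_velocity shear_pressure.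
Proof.
exists (fun _ _ _ => 0); last first.
  by apply: shear_regular_solution => i z; rewrite big1 ?oppr0.
move=> i j.
pose a (i : 'I_d.+1) := (i == ord0)%:R * A.
have vE k : (fun z => shear_velocity z ord0 k) = sf (a k) 0 (- a k).
  by apply/funext => z; rewrite shear_velocityE.
rewrite (_ : (fun z => _ * _) = sf (a i) 0 (- a i) \* sf (a j) 0 (- a j)); last first.
  by rewrite -!vE.
have cs k : continuous (sf (a k) 0 (- a k)) by exact: continuous_shear_fun.
apply: weak_derivative_smooth.
- by move=> z; apply: cvgM; exact: cs.
- by move=> z; exact: cvg_cst.
- move=> z; have ds k := @is_derive_shear_fun R d (mu ^+ 2) mu (a k) 0 (- a k) (space_dir j) z.
  have D := is_deriveM (ds i) (ds j).
  apply: DeriveDef; first exact: (@ex_derive _ _ _ _ _ _ _ D).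
  rewrite (@derive_val _ _ _ _ _ _ _ D).
  rewrite !space_dir1 !space_dir2 /GRing.scale/=.
  rewrite /a; have [->|_] := eqVneq j ord0; last first.
    by rewrite /shear_fun/= mulr0n; ring.
  by rewrite (eq_sym (ord_max : 'I_d.+1)) ord0_neq_max /shear_fun/= mulr0n ?mulr1n; ring.
Qed.

End shear_flow.

(** * Size of the velocity and of its gradient *)

Section integrals_in_time.
Local Open Scope ereal_scope.

Lemma integral_prod_snd d1 d2 (T1 : measurableType d1) (T2 : measurableType d2)
    (R : realType) (m1 : {sigma_finite_measure set T1 -> \bar R})
    (m2 : {sigma_finite_measure set T2 -> \bar R}) (D1 : set T1) (D2 : set T2)
    (g : T2 -> R) :
  measurable D1 -> measurable D2 -> measurable_fun setT g ->
  (forall t, 0 <= g t)%R ->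
  \int[m1 \x m2]_(z in D1 `*` D2) (g z.2)%:E =
  m1 D1 * \int[m2]_(t in D2) (g t)%:E.
Proof.
move=> mD1 mD2 mg g0.
pose h (t : T2) : \bar R := (\1_D2 t * g t)%:E.
have mh : measurable_fun setT h.
  by apply/measurable_EFinP; apply: measurable_funM => //; exact: measurable_indic.
have h0 t : 0 <= h t by rewrite lee_fin mulr_ge0.
have m1D : measurable_fun setT (fun x : T1 => (\1_D1 x : R)%:E).
  by apply/measurable_EFinP; exact: measurable_indic.
rewrite integral_mkcond.
transitivity (\int[m1 \x m2]_z ((\1_D1 z.1)%:E * h z.2)).
  apply: eq_integral => -[x t] _; rewrite /restrict /h !indicE in_setX/=.
  by case: (x \in D1); case: (t \in D2); rewrite /= ?mul1e ?mul0e ?mul1r ?mul0r ?mule0.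
rewrite fubini_tonelli1; first last.
- by move=> z; rewrite mule_ge0.
- apply: emeasurable_funM.
    exact: (measurableT_comp m1D measurable_fst).
  exact: (measurableT_comp mh measurable_snd).
rewrite /fubini_F/=.
under eq_integral do rewrite ge0_integralZl//.
rewrite ge0_integralZr//; last exact: integral_ge0.
rewrite integral_indic// setIT; congr (_ * _).
rewrite [RHS]integral_mkcond; apply: eq_integral => t _.
by rewrite /h /restrict indicE; case: (t \in D2); rewrite ?mul1r ?mul0r.
Qed.

Lemma integral_expR_le (R : realType) (c : R) : (0 < c)%R ->
  \int[@lebesgue_measure R]_(t in `[0%R, 1%R]) (expR (c * (t - 1)))%:E <= (c^-1)%:E.
Proof.
move=> c0; pose F (t : R) := (c^-1 * expR (c * (t - 1)))%R.
have dF (t : R) : is_derive t 1%R F (expR (c * (t - 1)))%R.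
  rewrite /F; apply: is_derive_eq.
  rewrite /GRing.scale/=. by field; rewrite gt_eqF.
have cF : continuous F.
  move=> t; apply: differentiable_continuous.
  by apply/derivable1_diffP; exact: ex_derive.
have cf : continuous (fun t : R => expR (c * (t - 1)))%R.
  move=> t; apply: continuous_comp; last exact: continuous_expR.
  by apply: cvgM; [exact: cvg_cst|apply: cvgB; [exact: cvg_id|exact: cvg_cst]].
rewrite (@continuous_FTC2 R _ F)//.
- rewrite /F subrr mulr0 expR0 mulr1 -EFinB lee_fin gerBl.
  by rewrite mulr_ge0 ?expR_ge0// invr_ge0 ltW.
- exact: continuous_subspaceT.
- split.
  + by move=> t _; exact: ex_derive.
  + exact/cvg_at_right_filter/cF.
  + exact/cvg_at_left_filter/cF.
- by move=> t _; rewrite derive1E; exact: derive_val.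
Qed.

End integrals_in_time.

Section norms_of_the_shear_flow.
Context {R : realType} {d : nat}.
Local Notation ST := (space_time R d.+1).
Local Notation leb := (@lebesgue_st R d.+1).

Lemma enorm_delta m n (c : R) (i : 'I_m) (j : 'I_n) :
  enorm (c *: delta_mx i j) = `|c|.
Proof.
rewrite /enorm (bigD1 i)//= (bigD1 j)//= !big1 => [|k /negbTE ki|k /negbTE kj].
- by rewrite !mxE !eqxx mulr1 !addr0 sqrtr_sqr.
- by rewrite big1// => l _; rewrite !mxE ki mulr0 expr0n.
- by rewrite !mxE kj andbF mulr0 expr0n.
Qed.

Lemma Q1_sub_cube : @Q1 R d `<=`
  cube d.+1 1 `*` `[0, 1]%classic.
Proof.
move=> -[x t] [/= [x1 _]]; rewrite in_itv/= => /andP[t0 t1]; split => [i|]/=.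
  by rewrite (le_lt_trans (ler_enorm x i)).
by rewrite in_itv/= !ltW.
Qed.

(** On the half space the factor 1 - exp(- mu x_n) lies between 0 and 1. *)
Lemma norm_shear_velocity (mu A : R) (z : ST) : 0 <= mu -> 0 <= A ->
  0 <= z.1 ord0 ord_max ->
  enorm (shear_velocity mu A z) <= A * expR (mu ^+ 2 * (z.2 - 1)).
Proof.
move=> mu0 A0 x0; rewrite enorm_delta /shear_fun mul0r addr0 mulNr -mulrBr.
rewrite normrM (ger0_norm A0) ler_wpM2l// ger0_norm ?gerBl ?expR_ge0//.
by rewrite subr_ge0 ler_expR gerBl mulr_ge0.
Qed.

(** The velocity is dominated by A exp(mu^2 (t - 1)); the integral of the p-th
    power of this bound over 0 < t < 1 is at most A^p / (p mu^2), and 2^(d+1) is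
    the volume of the cube of half side 1, which contains the half ball. *)
Lemma Lp_shear_velocity (mu A : R) (p : nat) : 0 < mu -> 0 <= A -> (0 < p)%N ->
  (Lp_enorm p%:R Q1 (@shear_velocity R d mu A) ^+ p <=
   (2 ^+ d.+1 * (A ^+ p / (p%:R * mu ^+ 2)))%:E)%E.
Proof.
move=> mu0 A0 p0; rewrite Lp_norm_exprn//.
pose g (t : R) := A ^+ p * expR (p%:R * mu ^+ 2 * (t - 1)).
pose B : set ST :=
  cube d.+1 1 `*` `[0, 1]%classic.
have mB : measurable B.
  by apply: measurableX; [exact: measurable_cube|exact: measurable_itv].
have g0 t : 0 <= g t by rewrite mulr_ge0 ?exprn_ge0 ?expR_ge0.
have cexp : continuous (fun t : R => expR (p%:R * mu ^+ 2 * (t - 1))).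
  move=> t; apply: continuous_comp; last exact: continuous_expR.
  by apply: cvgM; [exact: cvg_cst|apply: cvgB; [exact: cvg_id|exact: cvg_cst]].
have mg : measurable_fun setT (g : measurableTypeR R -> R).
  by apply: continuous_measurable_fun => t; apply: cvgM; [exact: cvg_cst|exact: cexp].
have mgz : measurable_fun setT (fun z : ST => (g z.2)%:E).
  by apply/measurable_EFinP; exact: (measurableT_comp mg measurable_snd).
have mv : @measurable_fun _ _ ST R setT
    (fun z => `|enorm (@shear_velocity R d mu A z)| ^+ p).
  apply: measurable_funX; apply: measurableT_comp => //.
  under eq_fun do rewrite enorm_delta; apply: measurableT_comp => //.
  by apply: continuous_measurable_st; exact: continuous_shear_fun.
apply: (@le_trans _ _ (\int[leb]_(z in Q1) (g z.2)%:E)%E).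
  apply: ge0_le_integral => //.
  - exact: measurable_Q1.
  - by apply/measurable_EFinP; exact: measurable_funTS.
  - exact: measurable_funTS.
  - move=> z [[_ x0] _]; rewrite lee_fin ger0_norm ?enorm_ge0//.
    rewrite /g -mulrA expRM_natl -exprMn lerXn2r ?nnegrE ?enorm_ge0//.
      by rewrite mulr_ge0 ?expR_ge0.
    by apply: norm_shear_velocity; rewrite // ltW.
apply: (@le_trans _ _ (\int[leb]_(z in B) (g z.2)%:E)%E).
  apply: ge0_subset_integral => //.
  - exact: measurable_Q1.
  - exact: measurable_funTS.
  - by move=> z _; rewrite lee_fin.
  - exact: Q1_sub_cube.
rewrite [leLHS](@integral_prod_snd _ _ _ _ R (lebesgue_rV d.+1) (@lebesgue_measure R))//; last first.
  exact: measurable_cube.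
rewrite lebesgue_rV_cube// [in leRHS]EFinM mulr2n lee_pmul2l//.
under eq_integral do rewrite EFinM.
rewrite ge0_integralZl//; first last.
- by rewrite lee_fin exprn_ge0.
- apply: measurable_funTS; apply/measurable_EFinP.
  exact: (continuous_measurable_fun cexp).
rewrite EFinM lee_wpmul2l ?lee_fin ?exprn_ge0// integral_expR_le//.
by rewrite mulr_gt0 ?ltr0n// exprn_gt0.
Qed.

(** The part of the boundary layer on which mu x_n < 1 and mu^2 (1 - t) < 1, so
    that the exponent of [shear_gradient] is at least -2; [delta] bounds the
    tangential coordinates. *)
Definition layer (delta mu : R) : set ST :=
  [set x : 'rV[R]_d.+1 | (forall j, `|x ord0 (lift ord_max j)| < delta) /\
     0 < x ord0 ord_max < mu^-1] `*` `]1 - (mu ^+ 2)^-1, 1[%classic.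

Lemma measurable_layer_section (delta mu : R) :
  measurable [set x : 'rV[R]_d.+1 | (forall j, `|x ord0 (lift ord_max j)| < delta) /\
     0 < x ord0 ord_max < mu^-1].
Proof.
rewrite (_ : [set x | _] =
  ((fun x => (@unsnoc R d x).1) @^-1` cube d delta)
   `&` ((fun x : 'rV[R]_d.+1 => x ord0 ord_max) @^-1` `]0, mu^-1[)); last first.
  apply/seteqP; split => x /= [xd x0]; rewrite /= in_itv/= in x0 *; split => // i.
    by rewrite mxE.
  by have := xd i; rewrite mxE.
apply: measurableI; rewrite -[X in measurable X]setTI.
  by apply: (measurableT_comp measurable_fst (@measurable_unsnoc R d)) => //;
    exact: measurable_cube.
exact: measurable_coord.
Qed.

Lemma measurable_layer (delta mu : R) : measurable (layer delta mu).
Proof.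
by apply: measurableX; [exact: measurable_layer_section|exact: measurable_itv].
Qed.

Lemma lebesgue_st_layer (delta mu : R) : 0 < delta -> 0 < mu ->
  leb (layer delta mu) = ((delta *+ 2) ^+ d / mu ^+ 3)%:E.
Proof.
move=> delta0 mu0.
have lsec : lebesgue_rV d.+1 [set x : 'rV[R]_d.+1 |
    (forall j, `|x ord0 (lift ord_max j)| < delta) /\
     0 < x ord0 ord_max < mu^-1] = ((delta *+ 2) ^+ d / mu)%:E.
  rewrite /= /snoc_measure /pushforward.
  rewrite (_ : _ @^-1` _ = cube d delta `*` `]0, mu^-1[%classic); last first.
    apply/seteqP; split => -[x t]/=.
      move=> [xr]; rewrite mxE unlift_none/= => t0; split => [i|].
        by have := xr i; rewrite mxE liftK.
      by rewrite in_itv.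
    move=> [xr]; rewrite in_itv/= => tr; split => [i|].
      by rewrite mxE liftK; exact: xr.
    by rewrite mxE unlift_none.
  transitivity (((delta *+ 2) ^+ d)%:E * lebesgue_measure (`]0%R, (mu^-1)%R[%classic))%E.
    rewrite -lebesgue_rV_cube//; apply: product_measure1E => //.
    exact: measurable_cube.
  by rewrite lebesgue_measure_itv/= lte_fin invr_gt0 mu0 -EFinB subr0 -EFinM.
transitivity (((delta *+ 2) ^+ d / mu)%:E *
    lebesgue_measure (`](1 - (mu ^+ 2)^-1)%R, 1%R[%classic))%E.
  rewrite -lsec; apply: product_measure1E => //; exact: measurable_layer_section.
rewrite lebesgue_measure_itv/= lte_fin gtrBl invr_gt0 exprn_gt0//.
by rewrite -EFinB -EFinM opprB addrCA subrr addr0 -mulrA -invfM -exprS.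
Qed.

(** All d + 1 coordinates are smaller than delta in absolute value, and
    (d + 1) delta^2 < 1/4; mu >= 2 makes mu^-2 at most 1/4. *)
Lemma layer_sub_Q12 (delta mu : R) : delta = (d.+2%:R * 2)^-1 -> delta^-1 <= mu ->
  layer delta mu `<=` @Q12 R d.
Proof.
move=> deltaE dmu [x t] [/= [xj /andP[x0 xn]]]; rewrite in_itv/= => /andP[t0 t1].
have delta0 : 0 < delta by rewrite deltaE invr_gt0 mulr_gt0// ltr0n.
have mu0 : 0 < mu by rewrite (lt_le_trans _ dmu)// invr_gt0.
have mu2 : 2 <= mu.
  by rewrite (le_trans _ dmu)// deltaE invrK ler_peMl// ler1n.
have xd i : `|x ord0 i| < delta.
  case: (unliftP ord_max i) => [j ->|->]; first exact: xj.
  rewrite gtr0_norm// (lt_le_trans xn)//.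
  by rewrite -[leRHS]invrK lef_pV2 ?posrE ?invr_gt0.
split; last first.
  rewrite /= in_itv/= t1 andbT (le_lt_trans _ t0)//.
  have : 4 <= mu ^+ 2 by rewrite expr2; nra.
  move=> mu4; have : (mu ^+ 2)^-1 <= 4^-1.
    by rewrite lef_pV2 ?posrE ?exprn_gt0.
  lra.
split => //=; rewrite /enorm big_ord1.
rewrite -[ltRHS]gtr0_norm// -sqrtr_sqr ltr_sqrt ?exprn_gt0//.
apply: (@le_lt_trans _ _ (\sum_(i < d.+1) delta ^+ 2)).
  apply: ler_sum => i _; rewrite -real_normK ?num_real// lerXn2r ?nnegrE//.
    exact: ltW.
  exact/ltW/xd.
rewrite sumr_const card_ord -[_ *+ d.+1]mulr_natl deltaE.
rewrite -[d.+2%:R]natr1; set n := d.+1%:R.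
have n1 : 1 <= n by rewrite ler1n.
rewrite invfM exprMn mulrA gtr_pMl ?exprn_gt0 ?invr_gt0// exprVn.
rewrite ltr_pdivrMr ?exprn_gt0 ?addr_gt0 ?(lt_le_trans _ n1)// mul1r expr2; nra.
Qed.

(** The gradient is at least A mu exp(-2) on [layer], whose measure is
    (2 delta)^d / mu^3. *)
Lemma Lp_shear_gradient (delta mu A : R) :
  delta = (d.+2%:R * 2)^-1 -> delta^-1 <= mu -> 0 <= A ->
  ((A ^+ 2 / mu * (expR (- 2) ^+ 2 * (delta *+ 2) ^+ d))%:E <=
   Lp_enorm 2 Q12 (@shear_gradient R d mu A) ^+ 2)%E.
Proof.
move=> deltaE dmu A0.
have delta0 : 0 < delta by rewrite deltaE invr_gt0 mulr_gt0// ltr0n.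
have mu0 : 0 < mu by rewrite (lt_le_trans _ dmu)// invr_gt0.
rewrite [leRHS](@Lp_norm_exprn _ _ _ _ 2)//.
have mG : @measurable_fun _ _ ST R setT
    (fun z => `|enorm (@shear_gradient R d mu A z)| ^+ 2).
  apply: measurable_funX; apply: measurableT_comp => //.
  under eq_fun do rewrite enorm_delta; apply: measurableT_comp => //.
  by apply: continuous_measurable_st; exact: continuous_shear_fun.
apply: (@le_trans _ _
  (\int[leb]_(z in layer delta mu) (`|enorm (@shear_gradient R d mu A z)| ^+ 2)%:E)%E); last first.
  apply: ge0_subset_integral => //.
  - exact: measurable_layer.
  - exact: measurable_Q12.
  - by apply/measurable_EFinP; exact: measurable_funTS.
  - exact: layer_sub_Q12.
apply: (@le_trans _ _ (\int[leb]_(z in layer delta mu)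
    (cst ((A * mu * expR (- 2)) ^+ 2)%:E z))%E).
  rewrite integral_cst; last exact: measurable_layer.
  rewrite [X in (_ <= _ * X)%E]lebesgue_st_layer// -EFinM lee_fin le_eqVlt.
  by apply/orP; left; apply/eqP; field; rewrite gt_eqF.
apply: ge0_le_integral => //.
- exact: measurable_layer.
- by move=> z _; rewrite lee_fin exprn_even_ge0.
- by apply/measurable_EFinP; exact: measurable_funTS.
- move=> [x t] [/= [_ /andP[x0 xn]]]; rewrite in_itv/= => /andP[t0 t1].
  rewrite lee_fin ger0_norm ?enorm_ge0// enorm_delta /shear_fun/= mul0r addr0 mul0r add0r.
  have Amu : 0 <= A * mu by rewrite mulr_ge0// ltW.
  have ge0 r : 0 <= A * mu * expR r by apply: mulr_ge0; rewrite ?expR_ge0.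
  rewrite ger0_norm//; apply: lerXn2r; rewrite ?nnegrE//.
  apply: ler_wpM2l => //; rewrite ler_expR.
  have h1 : mu * x ord0 ord_max <= 1.
    by rewrite mulrC -ler_pdivlMr// div1r ltW.
  have h2 : mu ^+ 2 * (1 - t) <= 1.
    by rewrite mulrC -ler_pdivlMr ?exprn_gt0// div1r; lra.
  lra.
Qed.

End norms_of_the_shear_flow.

(** * The sequence with unbounded gradients *)

Section sequences_of_extended_reals.
Context {R : realType}.
Implicit Types (x : \bar R) (a M : R) (f g : nat -> \bar R).

Lemma sqr_lee_le (x : \bar R) (a : R) : (0 <= x)%E -> 0 <= a ->
  ((a ^+ 2)%:E <= x ^+ 2)%E -> (a%:E <= x)%E.
Proof.
case: x => [r| |]//; last by move=> *; rewrite leey.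
by rewrite lee_fin -EFin_expe !lee_fin => r0 a0; rewrite ler_pXn2r.
Qed.

Lemma le_of_sqr_le (x : \bar R) (a : R) : (0 <= x)%E -> 1 <= a ->
  (x ^+ 2 <= a%:E)%E -> (x <= a%:E)%E.
Proof.
case: x => [r| |]//; rewrite -EFin_expe !lee_fin => r0 a1 ra.
by have [r1|r1] := leP r 1; [exact: le_trans a1|apply: le_trans ra; rewrite ler_eXnr// ltW].
Qed.

Lemma ereal_sup_range_lty (f : nat -> \bar R) (M : R) :
  (forall k, f k <= M%:E)%E -> (ereal_sup (range f) < +oo)%E.
Proof.
move=> fM; apply: (@le_lt_trans _ _ M%:E); last exact: ltry.
by apply: ge_ereal_sup => _ [k _ <-].
Qed.

Lemma unbounded_no_constant (f g : nat -> \bar R) (M : R) :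
  (forall k, 0 <= g k <= M%:E)%E -> f @ \oo --> +oo%E ->
  ~ exists c : R, forall k, (f k <= c%:E * g k)%E.
Proof.
move=> gM /cvgeyPge foo [c fc].
have [k _ /(_ k)/(_ (leqnn k))/=] := foo (`|c| * M + 1).
apply/negP; rewrite -ltNge.
have /andP[g0 gk] := gM k.
apply: (le_lt_trans (fc k)); apply: (@le_lt_trans _ _ (`|c|%:E * M%:E)%E).
  apply: (@le_trans _ _ (`|c|%:E * g k)%E).
    by apply: lee_wpmul2r => //; rewrite lee_fin ler_norm.
  exact: lee_wpmul2l.
by rewrite -EFinM lte_fin ltrDl.
Qed.

Lemma cvgey_sqr (f : nat -> \bar R) :
  f @ \oo --> +oo%E -> (fun k => (f k ^+ 2)%E) @ \oo --> +oo%E.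
Proof.
move=> /cvgeyPge foo; apply/cvgeyPge => a; near=> k.
have fk : ((Num.max a 1)%:E <= f k)%E by near: k; exact: foo.
apply: (@le_trans _ _ (f k)).
  by apply: le_trans fk; rewrite lee_fin le_max lexx.
have f1 : (1 <= f k)%E by apply: le_trans fk; rewrite lee_fin le_max lexx orbT.
by rewrite expe2 -[leLHS]mule1 lee_wpmul2l// (le_trans _ f1).
Unshelve. all: by end_near. Qed.

End sequences_of_extended_reals.

Section blow_up_sequence.
Context {R : realType} {d : nat}.
Local Notation ST := (space_time R d.+1).

(** The parameter m of the sequence, for which A = m^2 and mu = m^3. The shift
    makes mu large enough for [layer_sub_Q12] from the first term on. *)
Definition layer_scale (k : nat) : R := k%:R + d.+2%:R * 2.

Definition layer_velocity k : ST -> 'rV[R]_d.+1 :=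
  shear_velocity (layer_scale k ^+ 3) (layer_scale k ^+ 2).
Definition layer_gradient k : ST -> 'M[R]_d.+1 :=
  shear_gradient (layer_scale k ^+ 3) (layer_scale k ^+ 2).
Definition layer_pressure k : ST -> R :=
  shear_pressure (layer_scale k ^+ 3) (layer_scale k ^+ 2).

Lemma layer_scale_ge1 k : 1 <= layer_scale k.
Proof.
by rewrite -[leLHS]add0r lerD// mulr_ege1 ?ler1n.
Qed.

(** A^p / mu^2 = m^(2p - 6), which is at most 1 precisely when p <= 3. *)
Lemma layer_velocity_bounded k (p : nat) : (0 < p <= 3)%N ->
  (Lp_enorm p%:R Q1 (layer_velocity k) ^+ p <= (2 ^+ d.+1)%:E)%E.
Proof.
move=> /andP[p0 p3]; have m1 := layer_scale_ge1 k.
have m0 := lt_le_trans ltr01 m1.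
apply: (le_trans (Lp_shear_velocity _ _ p0)); rewrite ?exprn_gt0 ?exprn_ge0 ?(ltW m0)//.
rewrite lee_fin ler_piMr ?exprn_ge0//.
rewrite ler_pdivrMr ?mulr_gt0 ?ltr0n ?exprn_gt0// mul1r -!exprM.
rewrite (@le_trans _ _ (layer_scale k ^+ (3 * 2)))//.
  by rewrite ler_weXn2l//; exact: (leq_mul (leqnn 2) p3).
by rewrite ler_peMl ?exprn_ge0 ?ler1n// ltW.
Qed.

(** A^2 / mu = m. *)
Lemma layer_gradient_ge k :
  ((layer_scale k * (expR (- 2) ^+ 2 * ((d.+2%:R * 2)^-1 *+ 2) ^+ d))%:E <=
   Lp_enorm 2 Q12 (layer_gradient k) ^+ 2)%E.
Proof.
have m1 := layer_scale_ge1 k.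
have m0 := lt_le_trans ltr01 m1.
have -> : layer_scale k = (layer_scale k ^+ 2) ^+ 2 / layer_scale k ^+ 3.
  by field; rewrite gt_eqF.
apply: Lp_shear_gradient => //; last by rewrite exprn_ge0 ?(ltW m0).
rewrite invrK (@le_trans _ _ (layer_scale k))//; first by rewrite lerDr.
by rewrite ler_eXnr.
Qed.

Lemma layer_gradient_cvgy :
  (fun k => Lp_enorm 2 Q12 (layer_gradient k)) @ \oo --> +oo%E.
Proof.
apply/cvgeyPge => a; pose b := Num.max a 0.
pose C : R := expR (- 2) ^+ 2 * ((d.+2%:R * 2)^-1 *+ 2) ^+ d.
have C0 : 0 < C.
  by rewrite mulr_gt0 ?exprn_gt0 ?expR_gt0// mulrn_wgt0// invr_gt0.
near=> k; apply: (@le_trans _ _ b%:E); first by rewrite lee_fin le_max lexx.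
apply: sqr_lee_le; rewrite ?Lp_norm_ge0 ?le_max ?lexx ?orbT//.
apply: le_trans (layer_gradient_ge k); rewrite lee_fin -/C -ler_pdivrMr//.
apply: (@le_trans _ _ k%:R); last by rewrite lerDl mulr_ge0.
near: k; exact: nbhs_infty_ger.
Unshelve. all: by end_near. Qed.

End blow_up_sequence.

Local Open Scope ereal_scope.

Theorem theorem1p1 (R : realType) (d : nat) (hd : (2 <= d.+1)%N) :
  (* (i) Stokes equations *)
  ((~ exists c : R, forall (w : space_time R d.+1 -> 'rV[R]_d.+1)
        (pi : space_time R d.+1 -> R) (G : space_time R d.+1 -> 'M[R]_d.+1),
      stokes_solution w pi -> weak_gradient w G ->
      Lp_enorm 2 Q12 G <= c%:E * Lp_enorm 2 Q1 w) /\
   (exists (w : nat -> space_time R d.+1 -> 'rV[R]_d.+1)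
        (pi : nat -> space_time R d.+1 -> R)
        (G : nat -> space_time R d.+1 -> 'M[R]_d.+1),
      [/\ forall k, stokes_solution (w k) (pi k),
          forall k, weak_gradient (w k) (G k),
          ereal_sup (range (fun k => Lp_enorm 2 Q1 (w k))) < +oo &
          (fun k => Lp_enorm 2 Q12 (G k)) @ \oo --> +oo])) /\
  (* (ii) Navier-Stokes equations *)
  ((~ exists c : R, forall (u : space_time R d.+1 -> 'rV[R]_d.+1)
        (p : space_time R d.+1 -> R) (G : space_time R d.+1 -> 'M[R]_d.+1),
      navier_stokes_solution u p -> weak_gradient u G ->
      Lp_enorm 2 Q12 G ^+ 2 <=
        c%:E * (Lp_enorm 2 Q1 u ^+ 2 + Lp_enorm 3 Q1 u ^+ 3)) /\
   (exists (u : nat -> space_time R d.+1 -> 'rV[R]_d.+1)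
        (p : nat -> space_time R d.+1 -> R)
        (G : nat -> space_time R d.+1 -> 'M[R]_d.+1),
      [/\ forall k, navier_stokes_solution (u k) (p k),
          forall k, weak_gradient (u k) (G k),
          ereal_sup (range (fun k =>
            Lp_enorm 2 Q1 (u k) ^+ 2 + Lp_enorm 3 Q1 (u k) ^+ 3)) < +oo &
          (fun k => Lp_enorm 2 Q12 (G k)) @ \oo --> +oo])).
Proof.
have d0 : (0 < d)%N by [].
have stokes k : stokes_solution (@layer_velocity R d k) (layer_pressure k).
  exact: shear_stokes.
have navier k : navier_stokes_solution (@layer_velocity R d k) (layer_pressure k).
  exact: shear_navier_stokes.
have grad k : weak_gradient (@layer_velocity R d k) (layer_gradient k).
  exact: shear_weak_gradient.
have blowup := @layer_gradient_cvgy R d.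
have L2 k : 0 <= Lp_enorm 2 Q1 (@layer_velocity R d k) <= (2 ^+ d.+1)%R%:E.
  rewrite Lp_norm_ge0/=.
  apply: le_of_sqr_le; first exact: Lp_norm_ge0.
    by rewrite exprn_ege1 ?ler1n.
  exact: (@layer_velocity_bounded R d k 2 isT).
have L23 k : 0 <= Lp_enorm 2 Q1 (@layer_velocity R d k) ^+ 2 +
    Lp_enorm 3 Q1 (@layer_velocity R d k) ^+ 3 <= (2 ^+ d.+1 + 2 ^+ d.+1)%R%:E.
  rewrite adde_ge0 ?expe_ge0 ?Lp_norm_ge0//=.
  by rewrite EFinD leeD//; [exact: (@layer_velocity_bounded R d k 2 isT)|
    exact: (@layer_velocity_bounded R d k 3 isT)].
split; split.
- move=> [c cP]; apply: (unbounded_no_constant L2 blowup).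
  by exists c => k; exact: cP.
- exists layer_velocity, layer_pressure, layer_gradient; split => //.
  by apply: ereal_sup_range_lty => k; have /andP[_] := L2 k; exact.
- move=> [c cP]; apply: (unbounded_no_constant L23 (cvgey_sqr blowup)).
  by exists c => k; exact: cP.
- exists layer_velocity, layer_pressure, layer_gradient; split => //.
  by apply: ereal_sup_range_lty => k; have /andP[_] := L23 k; exact.
Qed.
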